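(* Suppose $\Delta t\in(0,0.5)$. For any $Y_0\in\mathbb{R}$, let $(Y_k)_{k\ge 0}$ be the Euler--Maruyama solution of the scalar SDE $$dx(t)=\frac{-3x(t)-x^3(t)}{1+t}\,dt+\frac{1}{(1+t)^3}\,dB(t)$$ with step size $\Delta t$ started at $Y_0$, that is, $$Y_{k+1}=Y_k+\frac{-3Y_k-Y_k^3}{1+k\Delta t}\,\Delta t+\frac{1}{(1+k\Delta t)^3}\,\Delta B_k,\qquad k=0,1,2,\dots.$$ Then $$\lim_{k\to\infty}\mathbb{E}|Y_k|=\infty.$$
   Context: $B(t)$ is a scalar Brownian motion on a complete filtered probability space $(\Omega,\mathcal{F},\{\mathcal{F}_t\}_{t\ge 0},\mathbb{P})$ (filtration increasing and right continuous, $\mathcal{F}_0$ containing all $\mathbb{P}$-null sets), and $\Delta B_k=B((k+1)\Delta t)-B(k\Delta t)$. The initial value $Y_0$ is deterministic. *)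

(* Defs.v *)
From mathcomp Require Import all_boot all_order all_algebra.
From mathcomp Require Import all_classical all_reals all_analysis.
Import Order.TTheory GRing.Theory Num.Theory.
Import numFieldNormedType.Exports.

Set Implicit Arguments.
Unset Strict Implicit.
Unset Printing Implicit Defensive.

Local Open Scope classical_set_scope.
Local Open Scope ring_scope.

(* Time is indexed by the whole of R; only the times t >= 0 are constrained
   or used. *)

Record usual_filtration (d : measure_display) (T : measurableType d)
    (R : realType) (P : probability T R) (F : R -> set (set T)) : Prop := {
  filtration_complete : measure_is_complete P;
  filtration_sigma_algebra : forall t : R, 0 <= t -> sigma_algebra [set: T] (F t);
  filtration_measurable : forall t : R, 0 <= t -> F t `<=` measurable;
  filtration_increasing :
    forall s t : R, 0 <= s -> s <= t -> F s `<=` F t;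
  filtration_right_continuous :
    forall t : R, 0 <= t -> F t = \bigcap_(u in `]t, +oo[) F u;
  filtration_null_sets : forall N, P.-negligible N -> F 0 N }.

Definition adapted (d : measure_display) (T : measurableType d)
    (R : realType) (F : R -> set (set T)) (X : R -> T -> R) : Prop :=
  forall t : R, 0 <= t -> forall A : set R, measurable A -> F t (X t @^-1` A).

Definition independent_of (d : measure_display) (T : measurableType d)
    (R : realType) (P : probability T R) (X : T -> R) (G : set (set T)) :
    Prop :=
  forall (E : set T) (A : set R), G E -> measurable A ->
    P (E `&` X @^-1` A) = (P E * P (X @^-1` A))%E.

(* The second argument of normal_prob is the standard deviation, whence the
   square root of the variance t - s. *)
Record brownian_motion (d : measure_display) (T : measurableType d)
    (R : realType) (P : probability T R) (F : R -> set (set T))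
    (B : R -> T -> R) : Prop := {
  brownian_adapted : adapted F B;
  brownian_start : {ae P, forall w, B 0 w = 0};
  brownian_continuous :
    {ae P, forall w, {within `[0, +oo[, continuous (fun t : R => B t w)}};
  brownian_increment_normal :
    forall s t : R, 0 <= s -> s < t -> forall A : set R, measurable A ->
      pushforward P (B t \- B s) A = normal_prob 0 (Num.sqrt (t - s)) A;
  brownian_increment_independent :
    forall s t : R, 0 <= s -> s < t -> independent_of P (B t \- B s) (F s) }.

(* Euler--Maruyama scheme with step dt for dx = f(x, t) dt + g(x, t) dB(t). *)
Fixpoint euler_maruyama (T : Type) (R : realType) (f g : R -> R -> R)
    (dt Y0 : R) (B : R -> T -> R) (k : nat) (w : T) : R :=
  if k is j.+1 then
    let Yj := euler_maruyama f g dt Y0 B j w in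
    let tj := j%:R * dt in
    Yj + f Yj tj * dt + g Yj tj * (B (j.+1%:R * dt) w - B tj w)
  else Y0.

(* Main.v *)
Require Import Defs.
From mathcomp Require Import all_boot all_order all_algebra.
From mathcomp Require Import all_classical all_reals all_analysis.
From mathcomp Require Import measurable_realfun ring lra.
Import Order.TTheory GRing.Theory Num.Theory.
Import numFieldNormedType.Exports.

Local Open Scope classical_set_scope.
Local Open Scope ring_scope.

(** The cubic drift makes the explicit scheme unstable far from the origin.
Write a = dt / (1 + t) for the effective step at time t.  As soon as
Y^2 a >= 4, the factor 1 - (3 + Y^2) a multiplying Y is at most -3, so the
iterate overshoots the origin and |Y| at least triples; if the noise is no
larger than |Y|, it at least doubles ([em_step_doubles]).  The damping 1/(1 + t)
weakens the drift only linearly in time whereas |Y|^2 is multiplied by 4 at each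
step, so the condition Y^2 a >= 4 perpetuates itself.

Hence, once the first increment has thrown the scheme far enough, it is enough
that the j-th increment stays below 2^(j+1) for every j >= 1 in order to get
|Y_k| >= 2^k M for all k >= 1 ([em_ge_on_blowup_event]).  The probability of this
happening up to any given step is bounded below by a positive constant: the
first increment, being Gaussian, lies in a prescribed interval with positive
probability q ([normal_prob_itv_gt0]), the tail bound
P(|N(0, s^2)| > r) <= 8 s^2 / r^2 ([normal_prob_centered_ge]) shows that the j-th
increment breaks its constraint with probability at most 4^-j, and these losses
multiply since each increment is independent of the past; the infinite product
of the factors 1 - 4^-j stays above 1/2 ([blowup_event_prob]).  Consequently
E|Y_k| >= 2^k M q / 2, which tends to infinity. *)

(** * Centred Gaussian laws *)

Lemma measurable_norm_le (R : realType) (c : R) :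
  measurable [set x : R | `|x| <= c].
Proof.
rewrite (_ : [set x | _] = `[- c, c]%classic)//.
by apply/seteqP; split => x /=; rewrite in_itv/= ler_norml.
Qed.

Lemma normal_prob_itv_gt0 (R : realType) (s a b : R) :
  s != 0 -> 0 <= a -> a < b -> (0 < normal_prob 0 s `[a, b])%E.
Proof.
move=> s0 a0 ab.
have peak0 := normal_peak_gt0 s0.
(* On the nonnegative half-line the density is smallest at the right end. *)
have pdfb0 : 0 < normal_pdf 0 s b.
  by rewrite normal_pdfE// mulr_gt0 ?expR_gt0.
apply: (@lt_le_trans _ _ (\int[lebesgue_measure]_(x in `[a, b])
    (cst (normal_pdf 0 s b)%:E x))%E).
  rewrite integral_cst//= lebesgue_measure_itv/= lte_fin ab -EFinD -EFinM.
  by rewrite lte_fin mulr_gt0 ?subr_gt0.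
apply: ge0_le_integral => //=.
- by move=> x _; rewrite lee_fin ltW.
- by apply/measurable_EFinP/measurable_funTS; exact: measurable_normal_pdf.
move=> x; rewrite in_itv/= => /andP[ax xb].
rewrite lee_fin normal_pdfE// ler_pM2l// ler_expR !subr0 !mulNr lerN2.
rewrite ler_pM2r ?invr_gt0 ?mulrn_wgt0 ?exprn_even_gt0//.
by rewrite ler_sqr ?nnegrE; lra.
Qed.

(** Splitting x^2 / (2 s^2) as 3 x^2 / (8 s^2) + x^2 / (2 (2 s)^2) trades part of
the Gaussian decay for a small constant while leaving a probability density, of
standard deviation 2 s; integrating then bounds the tail without computing any
moment. *)
Lemma normal_pdf_le_double (R : realType) (s c x : R) :
  s != 0 -> 0 < c -> c < `|x| ->
  normal_pdf 0 s x <= 8 * s ^+ 2 / c ^+ 2 * normal_pdf 0 (2 * s) x.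
Proof.
move=> s0 c0 cx.
have s20 : 0 < s ^+ 2 by rewrite exprn_even_gt0.
have c20 : 0 < c ^+ 2 by rewrite exprn_gt0.
have s80 : 0 < 8 * s ^+ 2 by rewrite mulr_gt0.
have c30 : 0 < 3 * c ^+ 2 by rewrite mulr_gt0.
have cx2 : c ^+ 2 <= x ^+ 2.
  by rewrite -(ger0_norm (sqr_ge0 x)) normrX ler_sqr ?nnegrE ?(ltW c0) ?(ltW cx).
have peakE : normal_peak (2 * s) = 2^-1 * normal_peak s.
  rewrite /normal_peak -invfM; congr (_^-1).
  rewrite exprMn -mulrA -mulrnAr sqrtrM ?sqr_ge0//.
  by rewrite sqrtr_sqr ger0_norm.
rewrite !normal_pdfE ?mulf_neq0// peakE /normal_fun !subr0.
have -> : - x ^+ 2 / (s ^+ 2 *+ 2) =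
    - (3 * x ^+ 2 / (8 * s ^+ 2)) + - x ^+ 2 / ((2 * s) ^+ 2 *+ 2).
  by field; rewrite s0.
rewrite expRD [leRHS](_ : _ = normal_peak s * (4 * s ^+ 2 / c ^+ 2 *
  expR (- x ^+ 2 / ((2 * s) ^+ 2 *+ 2)))); last by field; rewrite gt_eqF.
rewrite ler_wpM2l ?normal_peak_ge0// ler_wpM2r ?expR_ge0//.
(* exp(-u) <= 1/u suffices, as no better than a quadratic tail is sought. *)
rewrite expRN.
rewrite (@le_trans _ _ (3 * c ^+ 2 / (8 * s ^+ 2))^-1)//.
  have k0 : 0 < 3 * c ^+ 2 / (8 * s ^+ 2) by rewrite divr_gt0.
  rewrite lef_pV2 ?posrE ?expR_gt0//.
  apply: le_trans (_ : 3 * x ^+ 2 / (8 * s ^+ 2) <= _).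
    by rewrite ler_pM2r ?invr_gt0// ler_pM2l.
  by apply: le_trans (expR_ge1Dx _); rewrite lerDr.
rewrite invf_div ler_pdivrMr//.
rewrite [leRHS](_ : _ = 12 * s ^+ 2); first by lra.
by field; rewrite gt_eqF.
Qed.

(** A Chebyshev-type bound, up to the constant 8, obtained by integrating
[normal_pdf_le_double] outside [-c, c]. *)
Lemma normal_prob_centered_ge (R : realType) (s c : R) :
  s != 0 -> 0 < c ->
  ((1 - 8 * s ^+ 2 / c ^+ 2)%:E <= normal_prob 0 s [set x | (`|x| <= c)%R])%E.
Proof.
move=> s0 c0.
have mC := measurable_norm_le R c.
have := @probability_setC _ _ _ (normal_prob 0 s) _ (measurableC mC).
rewrite setCK => ->; rewrite EFinB leeB//.
set D := ~` _; have mD : measurable D by exact: measurableC.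
have mpdf t A : measurable_fun A (fun x => (normal_pdf 0 t x)%:E : \bar R).
  by apply/measurable_EFinP/measurable_funTS; exact: measurable_normal_pdf.
have k0 : 0 <= 8 * s ^+ 2 / c ^+ 2 by rewrite divr_ge0 ?sqr_ge0// mulr_ge0 ?sqr_ge0.
apply: (@le_trans _ _ (\int[lebesgue_measure]_(x in D)
    ((8 * s ^+ 2 / c ^+ 2)%:E * (normal_pdf 0 (2 * s) x)%:E))%E).
  apply: ge0_le_integral => //=.
  - by move=> x _; rewrite lee_fin normal_pdf_ge0.
  - exact: mpdf.
  - by apply: measurable_funeM; exact: mpdf.
  - move=> x /negP; rewrite -ltNge => cx; rewrite -EFinM lee_fin.
    exact: normal_pdf_le_double.
rewrite ge0_integralZl//; last 2 first.
- exact: mpdf.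
- by move=> x _; rewrite lee_fin normal_pdf_ge0.
rewrite -[leRHS]mule1 lee_wpmul2l//.
exact: (@probability_le1 _ _ _ (normal_prob 0 (2 * s))).
Qed.

(** * Measurability *)

(** The filtration is a family of sets of sets rather than of measurable types;
passing through the measurable type generated by G, which is G itself, makes
the measurability calculus available. *)
Lemma sigma_algebra_preimage_sub (T : pointedType) (R : realType)
    (G : set (set T)) (X Y : T -> R) : sigma_algebra [set: T] G ->
  (forall A, measurable A -> G (X @^-1` A)) ->
  (forall A, measurable A -> G (Y @^-1` A)) ->
  forall A, measurable A -> G ((X \- Y) @^-1` A).
Proof.
move=> sG GX GY A mA.
have mfun (Z : T -> R) : (forall A, measurable A -> G (Z @^-1` A)) ->
    measurable_fun [set: g_sigma_algebraType G] (Z : g_sigma_algebraType G -> R).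
  by move=> GZ _ C mC; rewrite setTI; apply: sub_sigma_algebra; exact: GZ.
have mXY := measurable_funB (mfun X GX) (mfun Y GY).
have := mXY measurableT A mA.
by rewrite setTI /measurable/= sigma_algebra_id.
Qed.

Lemma sigma_algebra_setI (T : pointedType) (G : set (set T)) (A B : set T) :
  sigma_algebra [set: T] G -> G A -> G B -> G (A `&` B).
Proof.
move=> /sigma_algebra_id <- GA GB.
exact: (@measurableI _ (g_sigma_algebraType G)).
Qed.

Lemma measurable_fun_expectation_ge (d : measure_display) (T : measurableType d)
    (R : realType) (P : probability T R) (X : T -> R) (A : set T) (m : R) :
  measurable_fun [set: T] X -> measurable A ->
  (forall w, 0 <= X w) -> (forall w, A w -> m <= X w) ->
  0 <= m -> (m%:E * P A <= 'E_P[X])%E.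
Proof.
move=> mX mA X0 mAX m0; rewrite unlock.
have mXA D : measurable_fun D (fun w => (X w)%:E).
  by apply/measurable_EFinP/measurable_funTS.
apply: (@le_trans _ _ (\int[P]_(w in A) (X w)%:E)%E).
  rewrite -integral_cst//; apply: ge0_le_integral => //=.
by apply: ge0_subset_integral => // w _; rewrite lee_fin.
Qed.

Lemma measurable_fun_euler_maruyama (d : measure_display)
    (T : measurableType d) (R : realType) (f g : R -> R -> R) (dt Y0 : R)
    (B : R -> T -> R) (k : nat) :
  (forall t, measurable_fun [set: R] (f ^~ t)) ->
  (forall t, measurable_fun [set: R] (g ^~ t)) ->
  (forall j : nat, measurable_fun [set: T] (B (j%:R * dt))) ->
  measurable_fun [set: T] (euler_maruyama f g dt Y0 B k).
Proof.
move=> mf mg mB; elim: k => [|k IH] /=; first exact: measurable_cst.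
apply: measurable_funD.
  apply: measurable_funD => //; apply: measurable_funM => //.
  exact: (measurableT_comp (mf _) IH).
apply: measurable_funM; last exact: measurable_funB.
exact: (measurableT_comp (mg _) IH).
Qed.

(** * Pathwise explosion *)

(** The drift sends y to - y (3 a + y^2 a - 1), whose modulus is at least
3 |y|; the noise n removes at most |y|. *)
Lemma em_step_doubles (R : realFieldType) (y a n : R) :
  0 <= a -> 4 <= y ^+ 2 * a -> `|n| <= `|y| ->
  2 * `|y| <= `|y + (- 3 * y - y ^+ 3) * a + n|.
Proof.
move=> a0 ya ny.
have -> : y + (- 3 * y - y ^+ 3) * a + n = n - y * (3 * a + y ^+ 2 * a - 1).
  by ring.
rewrite distrC; apply: le_trans (lerB_dist _ _); rewrite normrM.
rewrite (@ger0_norm _ (3 * a + _ - 1)); last by lra.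
have := normr_ge0 y; nra.
Qed.

Definition grid_increment {T : Type} {R : realType} (B : R -> T -> R) (dt : R)
    (j : nat) : T -> R := B (j.+1%:R * dt) \- B (j%:R * dt).

(** The event that drives the explosion. The geometric tolerance on the later
increments is slow enough to stay below the growth of the iterates and fast
enough for the exceedance probabilities to be summable. The first increment is
confined to a bounded interval because the Gaussian density is bounded below
there. *)
Fixpoint blowup_event {T : Type} {R : realType} (D : nat -> T -> R) (c : R)
    (n : nat) : set T :=
  if n is m.+1 then
    blowup_event D c m `&` D n @^-1` [set x | `|x| <= 2 ^+ n.+1]
  else D 0%N @^-1` `[c, c + 1].

(** On the blow-up event, the first step already gives |Y_1| >= 2 M and each
later one doubles the modulus. The bound 2 <= M makes 2^(n+1) M dominate the
increment allowed at step n+1, and 4 <= M^2 dt together with 1 + n <= 4^n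
maintains the threshold of [em_step_doubles]. *)
Lemma em_ge_on_blowup_event (T : Type) (R : realType) (B : R -> T -> R)
    (dt Y0 M : R) (n : nat) (w : T) :
  0 < dt -> dt <= 1 -> 2 <= M -> 4 <= M ^+ 2 * dt ->
  blowup_event (grid_increment B dt)
    (2 * M + `|Y0 + (- 3 * Y0 - Y0 ^+ 3) * dt|) n w ->
  2 ^+ n.+1 * M <= `|euler_maruyama
             (fun x t => (- 3 * x - x ^+ 3) / (1 + t))
             (fun _ t => 1 / (1 + t) ^+ 3)
             dt Y0 B n.+1 w|.
Proof.
move=> dt0 dt1 M2 Mdt; elim: n => [|n IH].
  rewrite /= /grid_increment/= in_itv/= !mul0r addr0 expr1n !divr1 expr1 mul1r.
  set r := Y0 + _ => /andP[+ _]; set x := _ - B 0 w => cx.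
  rewrite mul1r addrC; have := lerB_normD x r; have := ler_norm x; lra.
move=> [/IH{IH}]; set y := euler_maruyama _ _ _ _ _ _ _ => yM /=.
rewrite -/(euler_maruyama _ _ _ _ _ _ _) => Dn.
have p0 : 0 < 2 ^+ n.+1 :> R by rewrite exprn_gt0.
set t := n.+1%:R * dt.
have t0 : 0 <= t by rewrite mulr_ge0// ltW.
have t1 : 0 < 1 + t by lra.
change (2 ^+ n.+2 * M <= `|y + (- 3 * y - y ^+ 3) / (1 + t) * dt +
  1 / (1 + t) ^+ 3 * grid_increment B dt n.+1 w|).
rewrite exprS -mulrA; apply: le_trans (_ : 2 * `|y| <= _).
  by rewrite ler_pM2l.
rewrite mulrAC -mulrA; apply: em_step_doubles.
- by rewrite divr_ge0// ltW.
- (* 4 (1 + t) <= 4 * 4^(n+1) <= 4^(n+1) M^2 dt <= y^2 dt *)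
  have tn : 1 + t <= n.+2%:R.
    by rewrite -(natr1 n.+1) addrC lerD2r ler_piMr.
  have n4 : n.+2%:R <= 4 ^+ n.+1 :> R.
    by rewrite -natrX ler_nat ltn_expl.
  have y2 : 4 ^+ n.+1 * M ^+ 2 <= y ^+ 2.
    rewrite -[y ^+ 2]real_normK ?num_real//.
    rewrite (_ : 4 ^+ n.+1 = (2 ^+ n.+1) ^+ 2 :> R); last first.
      by rewrite exprAC; congr (_ ^+ _); rewrite expr2; lra.
    by rewrite -exprMn ler_sqr ?nnegrE ?mulr_ge0//; lra.
  rewrite mulrA ler_pdivlMr//.
  apply: le_trans (_ : 4 * 4 ^+ n.+1 <= _).
    by rewrite ler_pM2l//; lra.
  apply: le_trans (_ : 4 ^+ n.+1 * M ^+ 2 * dt <= _); last first.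
    by rewrite ler_pM2r.
  by rewrite -mulrA mulrC ler_pM2l// exprn_gt0.
- rewrite normrM; apply: le_trans yM.
  apply: le_trans (_ : 2 ^+ n.+2 <= _); last by rewrite exprS mulrC ler_pM2l.
  apply: le_trans Dn; rewrite ler_piMl//.
  rewrite div1r ger0_norm ?invr_ge0 ?exprn_ge0 ?(ltW t1)//.
  by rewrite invf_le1 ?exprn_gt0// exprn_ege1//; lra.
Qed.

(** * Probability of the explosion *)

Lemma grid_increment_law (R : realType) (d : measure_display)
    (T : measurableType d) (P : probability T R) (F : R -> set (set T))
    (B : R -> T -> R) (dt : R) (j : nat) (A : set R) :
  brownian_motion P F B -> 0 < dt -> measurable A ->
  P (grid_increment B dt j @^-1` A) = normal_prob 0 (Num.sqrt dt) A.
Proof.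
move=> hB dt0 mA.
rewrite -[LHS]/(pushforward P (grid_increment B dt j) A).
rewrite /grid_increment (brownian_increment_normal hB)//.
- by rewrite -mulrBl -natr1 addrC addKr mul1r.
- by rewrite mulr_ge0// ltW.
- by rewrite ltr_pM2r// ltr_nat.
Qed.

Lemma grid_increment_adapted (R : realType) (d : measure_display)
    (T : measurableType d) (P : probability T R) (F : R -> set (set T))
    (B : R -> T -> R) (dt : R) (j : nat) (A : set R) :
  usual_filtration P F -> brownian_motion P F B -> 0 < dt -> measurable A ->
  F (j.+1%:R * dt) (grid_increment B dt j @^-1` A).
Proof.
move=> hF hB dt0 mA.
have t0 (i : nat) : 0 <= i%:R * dt by rewrite mulr_ge0// ltW.
apply: sigma_algebra_preimage_sub mA.
- exact: (filtration_sigma_algebra hF).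
- by move=> C mC; exact: (brownian_adapted hB (t0 _)).
- move=> C mC; apply: (filtration_increasing hF (t0 j)).
    by rewrite ler_pM2r// ler_nat.
  exact: (brownian_adapted hB (t0 _)).
Qed.

Lemma blowup_event_adapted (R : realType) (d : measure_display)
    (T : measurableType d) (P : probability T R) (F : R -> set (set T))
    (B : R -> T -> R) (dt c : R) (n : nat) :
  usual_filtration P F -> brownian_motion P F B -> 0 < dt ->
  F (n.+1%:R * dt) (blowup_event (grid_increment B dt) c n).
Proof.
move=> hF hB dt0; have t0 (i : nat) : 0 <= i%:R * dt by rewrite mulr_ge0// ltW.
elim: n => [|n IH] /=.
  by apply: (grid_increment_adapted R d T P F) => //; exact: measurable_itv.
have hFn := filtration_sigma_algebra hF (t0 n.+2).
apply: sigma_algebra_setI => //.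
  apply: (filtration_increasing hF (t0 n.+1)) IH.
  by rewrite ler_pM2r// ler_nat.
by apply: (grid_increment_adapted R d T P F) => //; exact: measurable_norm_le.
Qed.

(** Independence of the past multiplies the probability by at least 1 - x^2 at
step n+1, where x = 2^-(n+1). The bound 1/2 + x is propagated instead of the
plain 1/2, because the induction needs the slack:
(1/2 + x) (1 - x^2) - (1/2 + x/2) = x (1 - 2 x) (1 + x) / 2 >= 0. *)
Lemma blowup_event_prob (R : realType) (d : measure_display)
    (T : measurableType d) (P : probability T R) (F : R -> set (set T))
    (B : R -> T -> R) (dt c : R) (n : nat) :
  usual_filtration P F -> brownian_motion P F B -> 0 < dt -> dt <= 2^-1 ->
  (normal_prob 0 (Num.sqrt dt) `[c, (c + 1)%R] * (2^-1 + 2 ^- n.+1)%:E <=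
   P (blowup_event (grid_increment B dt) c n))%E.
Proof.
move=> hF hB dt0 dt2; elim: n => [|n IH] /=.
  rewrite (grid_increment_law R d T P F)//.
  rewrite expr1 (_ : 2^-1 + 2^-1 = 1) ?mule1//; lra.
set E := blowup_event _ _ _ in IH *.
have t0 : 0 <= n.+1%:R * dt by rewrite mulr_ge0// ltW.
have mA := measurable_norm_le R (2 ^+ n.+2).
set A := [set x | _] in mA *.
have -> : P (E `&` grid_increment B dt n.+1 @^-1` A) =
    (P E * P (grid_increment B dt n.+1 @^-1` A))%E.
  apply: (brownian_increment_independent hB t0) => //.
    by rewrite ltr_pM2r// ltr_nat.
  exact: (blowup_event_adapted R d T P F B) hF hB dt0.
rewrite (grid_increment_law R d T P F)//.
set q := normal_prob _ _ `[c, _].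
have x0 : 0 < 2 ^- n.+1 :> R by rewrite invr_gt0 exprn_gt0.
have x2 : 2 ^- n.+1 <= 2^-1 :> R.
  by rewrite lef_pV2 ?posrE ?exprn_gt0// -[leLHS]expr1 ler_weXn2l//; lra.
set x := 2 ^- n.+1 in IH x0 x2 *.
have -> : 2 ^- n.+2 = x / 2 :> R by rewrite /x exprSr invfM.
apply: le_trans (_ : q * (2^-1 + x)%R%:E * (1 - x ^+ 2)%R%:E <= _)%E.
  rewrite -muleA -EFinM lee_wpmul2l ?measure_ge0// lee_fin; nra.
(* Here dt <= 1/2 bounds the tail at 2^(n+2) by x^2. *)
apply: lee_pmul => //.
- by rewrite mule_ge0 ?measure_ge0// lee_fin; lra.
- by rewrite lee_fin; nra.
have s0 : Num.sqrt dt != 0 by rewrite gt_eqF// sqrtr_gt0.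
have c0 : 0 < 2 ^+ n.+2 :> R by rewrite exprn_gt0.
apply: le_trans (normal_prob_centered_ge _ _ _ s0 c0).
rewrite lee_fin lerD2l lerN2 sqr_sqrtr ?(ltW dt0)//.
have -> : 8 * dt / (2 ^+ n.+2) ^+ 2 = 2 * dt * x ^+ 2.
  rewrite /x (exprS 2 n.+1); field.
  by rewrite expf_neq0.
by rewrite ler_piMl ?sqr_ge0//; lra.
Qed.

(** * Divergence of the first absolute moment *)

Theorem lemma3p3 (R : realType) (d : measure_display) (T : measurableType d)
    (P : probability T R) (F : R -> set (set T)) (B : R -> T -> R)
    (hF : usual_filtration P F) (hB : brownian_motion P F B)
    (dt : R) (hdt : 0 < dt < 2^-1) (Y0 : R) :
  let Y := euler_maruyama
             (fun x t => (- 3 * x - x ^+ 3) / (1 + t))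
             (fun _ t => 1 / (1 + t) ^+ 3)
             dt Y0 B in
  ('E_P[fun w => `|Y k w|%R] @[k --> \oo] --> +oo)%E.
Proof.
move=> Y; have /andP[dt0 dt2] := hdt.
(* Chosen so that M dt >= 4 and M >= 2, whence M^2 dt >= 4. *)
pose M := 2 + 4 / dt.
have M2 : 2 <= M by rewrite lerDl divr_ge0// ltW.
have Mdt : 4 <= M ^+ 2 * dt.
  have : M * dt = 2 * dt + 4 by rewrite /M; field; rewrite gt_eqF.
  nra.
pose c := 2 * M + `|Y0 + (- 3 * Y0 - Y0 ^+ 3) * dt|.
have c0 : 0 <= c by rewrite addr_ge0// mulr_ge0//; lra.
pose E n := blowup_event (grid_increment B dt) c n.
pose q := normal_prob 0 (Num.sqrt dt) `[c, c + 1].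
have q0 : (0 < q)%E.
  apply: normal_prob_itv_gt0 => //; last by rewrite ltrDl.
  by rewrite gt_eqF// sqrtr_gt0.
have qfin : q \is a fin_num by rewrite fin_num_measure//; exact: measurable_itv.
have fq0 : 0 < fine q by rewrite fine_gt0// q0 ltey_eq qfin.
have t0 (i : nat) : 0 <= i%:R * dt by rewrite mulr_ge0// ltW.
have mY k : measurable_fun [set: T] (fun w => `|Y k w|).
  apply: measurableT_comp => //; apply: measurable_fun_euler_maruyama.
  - by move=> t; apply: measurable_funM => //; exact: measurable_funB.
  - by move=> t; exact: measurable_cst.
  - move=> j _ A mA; rewrite setTI.
    exact: (filtration_measurable hF (t0 j)) (brownian_adapted hB (t0 j) mA).
have EY n : ((2 ^+ n * fine q)%R%:E <= 'E_P[fun w => `|Y n.+1 w|%R])%E.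
  have mE : measurable (E n).
    apply: (filtration_measurable hF (t0 n.+1)).
    exact: (blowup_event_adapted R d T P F B) hF hB dt0.
  have M0 : 0 <= 2 ^+ n.+1 * M by rewrite mulr_ge0 ?exprn_ge0//; lra.
  apply: le_trans (measurable_fun_expectation_ge _ _ _ P _ (E n)
    (2 ^+ n.+1 * M) (mY n.+1) mE _ _ M0).
  - apply: le_trans (_ : (2 ^+ n.+1 * M)%R%:E * (q * (2^-1 + 2 ^- n.+1)%R%:E) <= _)%E.
      rewrite -(fineK qfin) -!EFinM lee_fin.
      have : 0 < 2 ^- n.+1 :> R by rewrite invr_gt0 exprn_gt0.
      move: (2 ^- n.+1) => u u0; rewrite exprS.
      have v0 : 0 < 2 ^+ n :> R by rewrite exprn_gt0.
      set v := 2 ^+ n in v0 *.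
      rewrite [leRHS](_ : _ = v * fine q * (M * (1 + 2 * u))).
        by rewrite ler_peMr ?mulr_ege1 ?mulr_ge0 ?(ltW v0) ?(ltW fq0)//; lra.
      by field.
    apply: lee_wpmul2l; first by rewrite lee_fin.
    by apply: blowup_event_prob hF hB dt0 _; exact: ltW.
  - by move=> w; exact: normr_ge0.
  - by move=> w; apply: em_ge_on_blowup_event => //; lra.
rewrite -cvg_shiftS/=.
apply/cvgeyPge => A.
have := nbhs_infty_ger (A / fine q); apply: filterS => n An.
apply: le_trans (EY n); rewrite lee_fin -ler_pdivrMr//.
by apply: le_trans An _; rewrite -natrX ler_nat ltnW// ltn_expl.
Qed.
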